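(* Let $n,s,k$ be integers with $k\geq 2$, $s\geq 3$ and $n\geq sk+1$. Then the automorphism group of the $s$-stable Kneser graph $KG(n,k)_{s\text{-stab}}$ is isomorphic to the automorphism group of the graph $G(n,k,s)$.
   Context: Let $[n]=\{1,\dots,n\}$. A subset $S\subseteq[n]$ is $s$-stable if for all distinct $i,j\in S$ we have $s\leq |i-j|\leq n-s$. $[n]^k_s$ denotes the family of $s$-stable $k$-element subsets of $[n]$. The $s$-stable Kneser graph $KG(n,k)_{s\text{-stab}}$ has vertex set $[n]^k_s$, two vertices being adjacent iff the corresponding $k$-subsets are disjoint. The graph $G(n,k,s)$ has vertex set $[n]$, and two distinct vertices $i,j$ are adjacent iff there is no $S\in[n]^k_s$ with $\{i,j\}\subseteq S$. *)

(* Defs.v *)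
From HB Require Import structures.
From mathcomp Require Import all_boot all_fingroup ssralg ssrint.

Set Implicit Arguments.
Unset Strict Implicit.
Unset Printing Implicit Defensive.

(* The ground set {1, ..., n} is represented by 'I_n = {0, ..., n - 1}; the
   shift i |-> i - 1 preserves all the differences |i - j|. *)

(* `|i - j| is the distance computed in int; n - s is truncated, which is
   harmless when s <= n. *)
Definition s_stable (n s : nat) (S : {set 'I_n}) : bool :=
  [forall i in S, forall j in S, (i != j) ==> (s <= `|i - j| <= n - s)%N].

Definition stable_subsets (n k s : nat) : {set {set 'I_n}} :=
  [set S : {set 'I_n} | (#|S| == k) && s_stable s S].

Definition stable_kneser_vertex (n k s : nat) : finType :=
  {S : {set 'I_n} | S \in stable_subsets n k s}.

Definition stable_kneser (n k s : nat) : rel (stable_kneser_vertex n k s) :=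
  fun A B => [disjoint val A & val B].

Definition stable_graph (n k s : nat) : rel 'I_n :=
  fun i j => (i != j) &&
    ~~ [exists S in stable_subsets n k s, [set i; j] \subset S].

Definition graph_aut (T : finType) (e : rel T) : {set {perm T}} :=
  [set p : {perm T} | [forall x, forall y, e (p x) (p y) == e x y]].

Lemma graph_aut_group_set (T : finType) (e : rel T) : group_set (graph_aut e).
Proof.
apply/group_setP; split.
  by rewrite inE; apply/forallP=> x; apply/forallP=> y; rewrite !perm1.
move=> p q; rewrite !inE => /forallP Hp /forallP Hq.
apply/forallP=> x; apply/forallP=> y; rewrite !permM.
by move/forallP: (Hq (p x)) => /(_ (p y)) /eqP ->; move/forallP: (Hp x).
Qed.

Canonical graph_aut_group (T : finType) (e : rel T) : {group {perm T}} :=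
  Group (graph_aut_group_set e).

(* Main.v *)
(** The k-subsets of [n] that are independent in G(n,k,s) are the s-stable ones, so
    Aut G(n,k,s) acts on the Kneser graph KG(n,k)_{s-stab}; the point is that every
    automorphism [f] of the latter is induced by a permutation of [n].

    - For non-adjacent [A <> B], some stable [D] inside [A :|: B] arises from [A] by
      exchanging one element; moreover every point outside [A :|: D] lies on a
      stable set missing [A :|: D]. Hence [|A \ B| = 1] holds iff the common
      neighbourhood of [A] and [B] is maximal, and [f] preserves this relation.
    - Call such a pair (A, B) an arc at the point [a] with [A \ B = {a}]. If
      (A, B) and (C, E) are arcs with [B], [C] disjoint, [A], [E] disjoint and
      [A], [C] not disjoint, then both are arcs at the same point. As [s >= 3],
      any two arcs at the same point are joined by a chain of such links, so [f]
      induces an injective map [h] on points.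
    - If [a] is not in [D], some arc (C, E) at [a] has [C] disjoint from [D], so
      [h a] is not in [f D]. Hence [f D] is contained in [h @: D], and they have
      the same cardinality. *)

Require Import Defs.
From HB Require Import structures.
From mathcomp Require Import all_boot all_fingroup.
From mathcomp Require Import ssralg ssrint zify.

Set Implicit Arguments.
Unset Strict Implicit.
Unset Printing Implicit Defensive.

(** * Cyclic offsets from a base point *)

Section Shift.

Variable n : nat.
Implicit Types (a : 'I_n) (u v : nat).

Lemma shift_subproof a v : (a + v) %% n < n.
Proof. by rewrite ltn_pmod //; apply: leq_ltn_trans (ltn_ord a). Qed.

Definition shift a v : 'I_n := Ordinal (shift_subproof a v).

Lemma shiftE a v : v < n ->
  (shift a v : nat) = if a + v < n then a + v else a + v - n.
Proof.
move=> lt_vn; have lt_an := ltn_ord a; rewrite /=.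
case: ltnP => le_av; first by rewrite modn_small.
by rewrite -{1}(subnK le_av) modnDr modn_small //; lia.
Qed.

Lemma shift0 a : shift a 0 = a.
Proof. by apply: val_inj; rewrite /= addn0 modn_small. Qed.

Lemma shift_inj a u v : u < n -> v < n -> shift a u = shift a v -> u = v.
Proof.
move=> lt_u lt_v /(congr1 val) /=.
rewrite -![(_ + _) %% n]/(nat_of_ord (shift _ _)) !shiftE //.
by have := ltn_ord a; do 2!case: ifP; lia.
Qed.

Lemma shift_surj a x : exists2 v, v < n & x = shift a v.
Proof.
have [lt_a lt_x] := (ltn_ord a, ltn_ord x).
pose v := if a <= x then x - a else x + n - a.
have lt_v : v < n by rewrite /v; case: ifP; lia.
exists v => //; apply: val_inj => /=.
rewrite -[(_ + _) %% n]/(nat_of_ord (shift _ _)) shiftE // /v.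
by case: (leqP a x) => *; case: ifP; lia.
Qed.

(** Stability is invariant under rotation: it says that both arcs between two points of the cycle
    have length at least [s], which the offsets show without the absolute value. *)
Lemma shift_far s a u v : u < n -> v < n ->
  (s <= `|shift a u - shift a v| <= n - s)%N =
  ((u + s <= v) && (v + s <= u + n)) || ((v + s <= u) && (u + s <= v + n)).
Proof.
move=> lt_u lt_v; rewrite !shiftE //; have lt_a := ltn_ord a.
case: ifP; case: ifP; lia.
Qed.

End Shift.

Lemma disjointPn (T : finType) (A B : {set T}) :
  ~~ [disjoint A & B] -> exists2 x, x \in A & x \in B.
Proof.
rewrite disjoint_subset => /subsetPn[x xA]; rewrite inE negbK => xB.
by exists x.
Qed.

Lemma graph_autP (T : finType) (e : rel T) (f : {perm T}) :
  reflect (forall x y, e (f x) (f y) = e x y) (f \in graph_aut e).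
Proof.
rewrite inE; apply: (iffP forallP) => [eq_e x y|eq_e x].
  by have /forallP/(_ y)/eqP := eq_e x.
by apply/forallP=> y; rewrite eq_e.
Qed.

Lemma perm_imsetD (T : finType) (g : {perm T}) (A B : {set T}) :
  g @: (A :\: B) = g @: A :\: g @: B.
Proof.
apply/setP=> x; rewrite -(permKV g x) inE !mem_imset ?inE //; exact: perm_inj.
Qed.

(** * Stable sets as increasing sequences of offsets *)

Section StableSets.

Variables n s k : nat.
Hypotheses (k_ge2 : 2 <= k) (s_ge3 : 3 <= s) (n_gt : s * k < n).
Implicit Types (a x y : 'I_n) (A B C D E : {set 'I_n}) (p q : nat -> nat).

Local Notation stab := (stable_subsets n k s).

(* [spread p] says that the offsets [p 0 < ... < p k.-1], measured from any base
   point, are those of an s-stable k-set; the values [p i] for [k <= i] are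
   irrelevant. *)
Definition spread p :=
  [/\ forall i, i.+1 < k -> p i + s <= p i.+1, p k.-1 < n
    & p k.-1 + s <= p 0 + n].

Definition spread_set a p : {set 'I_n} := [set shift a (p i) | i : 'I_k].

Lemma spread_gap p i d : spread p -> i + d < k -> p i + d * s <= p (i + d).
Proof.
case=> gap _ _; elim: d => [|d IHd] lt_k; first by rewrite addn0; lia.
have := IHd ltac:(lia); have := gap (i + d) ltac:(lia); rewrite addnS; lia.
Qed.

Lemma spread_mono p i j : spread p -> i < j -> j < k -> p i + s <= p j.
Proof.
move=> sp lt_ij lt_jk; have := @spread_gap p i (j - i) sp.
rewrite (subnKC (ltnW lt_ij)) => /(_ lt_jk).
by apply: leq_trans; rewrite leq_add2l leq_pmull ?subn_gt0.
Qed.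

Lemma spread_le p i j : spread p -> i <= j -> j < k -> p i <= p j.
Proof.
move=> sp; rewrite leq_eqVlt => /predU1P[-> //|lt_ij lt_jk].
by have := spread_mono sp lt_ij lt_jk; lia.
Qed.

Lemma spread_lt p i : spread p -> i < k -> p i < n.
Proof.
move=> sp lt_i; have := @spread_le p i k.-1 sp ltac:(lia) ltac:(lia).
by case: sp; lia.
Qed.

Lemma mem_spread_set a p v : spread p -> v < n ->
  reflect (exists2 i, i < k & p i = v) (shift a v \in spread_set a p).
Proof.
move=> sp lt_v; apply: (iffP imsetP) => [[i _ eq_v]|[i lt_i <-]].
  by exists i => //; rewrite (shift_inj lt_v _ eq_v) //; apply: spread_lt.
by exists (Ordinal lt_i).
Qed.

Lemma spread_set_elem a p x : x \in spread_set a p ->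
  exists2 i, i < k & x = shift a (p i).
Proof. by case/imsetP=> i _ ->; exists i. Qed.

Lemma mem_spread_set_idx a p i : i < k -> shift a (p i) \in spread_set a p.
Proof. by move=> lt_i; apply/imsetP; exists (Ordinal lt_i). Qed.

Lemma eq_spread_set a p q : (forall i, i < k -> p i = q i) ->
  spread_set a p = spread_set a q.
Proof. by move=> eq_pq; apply: eq_imset => i /=; rewrite eq_pq. Qed.

Lemma spread_set_stable a p : spread p -> spread_set a p \in stab.
Proof.
move=> sp; rewrite inE; apply/andP; split.
  rewrite card_imset ?card_ord // => i j /shift_inj eq_ij.
  have {}eq_ij : p i = p j by apply: eq_ij; apply: spread_lt.
  apply: val_inj => /=; case: (ltngtP i j) => // lt_ij.
    by have := spread_mono sp lt_ij (ltn_ord j); lia.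
  by have := spread_mono sp lt_ij (ltn_ord i); lia.
apply/forall_inP=> _ /imsetP[i _ ->]; apply/forall_inP=> _ /imsetP[j _ ->].
apply/implyP => neq_ij; rewrite shift_far ?spread_lt //.
have [_ _ wrap] := sp.
have lo (l : 'I_k) : p 0 <= p l by apply: spread_le.
have hi (l : 'I_k) : p l <= p k.-1.
  by apply: spread_le => //; have := ltn_ord l; lia.
move: (lo i) (lo j) (hi i) (hi j); case: (ltngtP i j) => [lt_ij|lt_ji|/val_inj eq_ij].
- by have := spread_mono sp lt_ij (ltn_ord j); lia.
- by have := spread_mono sp lt_ji (ltn_ord i); lia.
- by rewrite eq_ij eqxx in neq_ij.
Qed.

Lemma stable_card A : A \in stab -> #|A| = k.
Proof. by rewrite inE => /andP[/eqP]. Qed.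

Lemma stable_far a A u v : A \in stab -> u < n -> v < n -> u < v ->
  shift a u \in A -> shift a v \in A -> (u + s <= v) && (v + s <= u + n).
Proof.
rewrite inE => /andP[_ /forall_inP stA] lt_u lt_v lt_uv Au Av.
have /forall_inP/(_ _ Av) := stA _ Au; rewrite shift_far //.
have /negPf-> : shift a u != shift a v.
  by apply: contraTN lt_uv => /eqP/(shift_inj lt_u lt_v)->; rewrite ltnn.
by move=> /=; lia.
Qed.

Lemma stable_spread a A : A \in stab ->
  exists2 p, spread p & A = spread_set a p.
Proof.
(* [t] lists the offsets of [A] in increasing order; the default 0 of [nth] only affects irrelevant
   indices. *)
move=> stA; pose t := [seq v <- iota 0 n | shift a v \in A].
have mem_t v : (v \in t) = (v < n) && (shift a v \in A).
  by rewrite mem_filter mem_iota andbC.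
have defA : A =i [seq shift a v | v <- t].
  move=> x; have [v lt_v ->] := shift_surj a x.
  apply/idP/mapP => [Av|[u]]; first by exists v; rewrite // mem_t lt_v.
  by rewrite mem_t => /andP[lt_u Au] /(shift_inj lt_v lt_u)->.
have uniq_t : uniq t by rewrite filter_uniq ?iota_uniq.
have sz_t : size t = k.
  rewrite -(stable_card stA) (eq_card defA) (card_uniqP _) ?size_map //.
  rewrite map_inj_in_uniq // => u v; rewrite !mem_t => /andP[lt_u _] /andP[lt_v _].
  exact: shift_inj.
have sort_t : sorted ltn t by rewrite sorted_filter ?iota_ltn_sorted //; exact: ltn_trans.
pose p := nth 0 t.
have tp i : i < k -> (p i < n) && (shift a (p i) \in A).
  by move=> lt_i; rewrite -mem_t mem_nth ?sz_t.
have p_mono i j : i < j -> j < k -> p i < p j.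
  move=> lt_ij lt_j; apply: (sorted_ltn_nth ltn_trans 0 sort_t) => //.
    by rewrite inE sz_t (ltn_trans lt_ij).
  by rewrite inE sz_t.
exists p.
  have far i j : i < j -> j < k -> (p i + s <= p j) && (p j + s <= p i + n).
    move=> lt_ij lt_j; have /andP[lti Ai] := tp i ltac:(lia).
    have /andP[ltj Aj] := tp j lt_j.
    by apply: (stable_far stA lti ltj) Ai Aj; apply: p_mono.
  split=> [i lt_i||]; first by have := far i i.+1 ltac:(lia) lt_i; lia.
    by have := tp k.-1 ltac:(lia); lia.
  by have := far 0 k.-1 ltac:(lia) ltac:(lia); lia.
apply/setP=> x; rewrite defA; apply/mapP/imsetP => [[v tv ->]|[i _ ->]].
  have lt_v : index v t < k by rewrite -sz_t index_mem.
  by exists (Ordinal lt_v); rewrite //= /p nth_index.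
by exists (p i); rewrite // mem_nth ?sz_t.
Qed.

Lemma spread_inj p i j : spread p -> i < k -> j < k -> p i = p j -> i = j.
Proof.
move=> sp lt_i lt_j eq_p; case: (ltngtP i j) => // lt_ij.
  by have := spread_mono sp lt_ij lt_j; lia.
by have := spread_mono sp lt_ij lt_i; lia.
Qed.

Lemma spread0 a p : spread p -> (a \in spread_set a p) = (p 0 == 0).
Proof.
move=> sp; have n_gt0 : 0 < n by lia.
rewrite -{1}(shift0 a); apply/(mem_spread_set a sp n_gt0)/eqP => [[i lt_i p_i]|p0].
  by have := spread_le sp (leq0n i) lt_i; lia.
by exists 0; lia.
Qed.

Lemma spread_set_disjoint a p q : spread p -> spread q ->
    (forall i j, i < k -> j < k -> p i <> q j) ->
  [disjoint spread_set a p & spread_set a q].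
Proof.
move=> sp sq neq; rewrite disjoint_subset; apply/subsetP=> x /spread_set_elem[i lt_i ->].
apply/negP=> /(mem_spread_set a sq (spread_lt sp lt_i))[j lt_j /esym].
exact: neq.
Qed.

Lemma spread_set_diff a p q : spread p -> spread q -> p 0 = 0 -> 0 < q 0 ->
    (forall i, 0 < i -> i < k -> exists2 j, j < k & q j = p i) ->
  spread_set a p :\: spread_set a q = [set a].
Proof.
move=> sp sq p0 q0 sub; apply/setP=> x; rewrite !inE.
apply/andP/eqP => [[qx /spread_set_elem[[|i] lt_i def_x]]|->].
- by rewrite def_x p0 shift0.
- have [j lt_j eq_j] := sub i.+1 isT lt_i.
  by case/negP: qx; rewrite def_x -eq_j mem_spread_set_idx.
- by rewrite !spread0 // p0; split=> //; lia.
Qed.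

(** * Stable sets interleaved with a given one *)

(* When the base point lies outside the set with offsets [p], [low p] and
   [high p] are the extreme stable sets through the base point having exactly
   one element in each gap of [p]. *)
Definition low p i := if i is j.+1 then maxn (p j).+1 (j.+1 * s) else 0.

(** Both arguments of the maximum grow by at least [s] per step, hence so does the maximum. The last
    gap closes because [p (k - 2) + 1 + s <= p (k - 1) + 1 <= n] and [s * k < n]. *)
Lemma low_spread p : spread p -> 0 < p 0 -> spread (low p).
Proof.
move=> sp p0; have [gap last wrap] := sp; split=> [[|i] lt_i||] /=.
- by rewrite mul1n; lia.
- by have := gap i ltac:(lia); rewrite mulSn; lia.
- case def_k: k.-1 => [|j] /=; first lia.
  have := gap j ltac:(lia); have def_k' : k = j.+2 by lia.
  by move: last n_gt; rewrite def_k' /= mulnC !mulSn; lia.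
- case def_k: k.-1 => [|j] /=; first lia.
  have := gap j ltac:(lia); have def_k' : k = j.+2 by lia.
  by move: last n_gt; rewrite def_k' /= mulnC !mulSn; lia.
Qed.

(** Both arguments of the maximum stay below [p i.+1], since [p 0 > 0]; so [low p i.+1] lies
    strictly between [p i] and [p i.+1]. *)
Lemma low_neq p i j : spread p -> 0 < p 0 -> i < k -> j < k -> low p i <> p j.
Proof.
move=> sp p0; case: i => [|i] lt_i lt_j /=.
  by have := spread_le sp (leq0n j) lt_j; lia.
case: (leqP j i) => [le_ji|lt_ij].
  by have := spread_le sp le_ji ltac:(lia); lia.
have := spread_le sp lt_ij lt_j; have := @spread_gap p 0 i.+1 sp lt_i.
by have := @spread_mono p i i.+1 sp ltac:(lia) lt_i; rewrite add0n; lia.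
Qed.

(** If [p i < v] then [low p i.+1 < p i + s <= v]; otherwise [low p i.+1 > p i >= v]. *)
Lemma low_avoid p i v : spread p -> 0 < p 0 -> 0 < v ->
    (forall j, j < k -> p j < v -> p j + s <= v) ->
  i < k -> low p i <> v.
Proof.
move=> sp p0 v0 far; case: i => [|i] lt_i /=; first by lia.
move=> def_v; have := far i ltac:(lia) ltac:(lia).
by have := @spread_gap p 0 i sp ltac:(lia); rewrite add0n mulSn in def_v *; lia.
Qed.

Definition high p i := if i is j.+1 then minn (p i).-1 (n - (k - i) * s) else 0.

(** The [d] offsets after [p i] need room. This puts [n - d * s] strictly above [p i], so that
    [high p i.+1] does not fall below its gap. *)
Lemma high_bound p i d : spread p -> k = (i + d).+1 -> p i + d * s < n.
Proof.
move=> sp def_k; have := @spread_gap p i d sp ltac:(lia).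
by have := @spread_lt p (i + d) sp ltac:(lia); lia.
Qed.

Lemma high_spread p : spread p -> 0 < p 0 -> spread (high p).
Proof.
move=> sp p0; have [gap last wrap] := sp; split=> [[|i] lt_i||] /=.
- have := gap 0 lt_i; have := n_gt.
  have -> : k = (k - 1).+1 by lia.
  by rewrite mulnS subSS subn0 mulnC; lia.
- have := gap i.+1 lt_i; have -> : k - i.+1 = (k - i.+2).+1 by lia.
  have : s * k = i.+2 * s + (k - i.+2) * s by rewrite -mulnDl subnKC 1?mulnC // ltnW.
  have := @spread_le p 0 i.+1 sp isT ltac:(lia).
  by have := n_gt; rewrite !mulSn; lia.
- case def_k: k.-1 => [|j] /=; first lia.
  by rewrite -def_k; lia.
- case def_k: k.-1 => [|j] /=; first lia.
  have -> : k - j.+1 = 1 by lia.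
  by rewrite -def_k mul1n; have := n_gt; case: (k) k_ge2 => // k' _; rewrite mulnS; lia.
Qed.

Lemma high_neq p i j : spread p -> 0 < p 0 -> i < k -> j < k -> high p i <> p j.
Proof.
move=> sp p0; case: i => [|i] lt_i lt_j /=.
  by have := spread_le sp (leq0n j) lt_j; lia.
have pi0 := spread_le sp (leq0n i.+1) lt_i.
case: (leqP i.+1 j) => [le_ij|lt_ji].
  by have := spread_le sp le_ij lt_j; lia.
have := @spread_mono p i i.+1 sp ltac:(lia) lt_i.
have := @spread_le p j i sp ltac:(lia) ltac:(lia).
have := @high_bound p i (k - i.+1) sp ltac:(lia).
have : s * k = i.+1 * s + (k - i.+1) * s by rewrite -mulnDl subnKC 1?mulnC // ltnW.
lia.
Qed.

Lemma high_avoid p i v : spread p -> 0 < p 0 -> 0 < v ->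
    (forall j, j < k -> v < p j -> v + s <= p j) ->
  i < k -> high p i <> v.
Proof.
move=> sp p0 v0 far; case: i => [|i] lt_i /=; first by lia.
have := @high_bound p i.+1 (k - i.+2) sp ltac:(lia).
have -> : k - i.+1 = (k - i.+2).+1 by lia.
have pi0 := spread_le sp (leq0n i.+1) lt_i.
by rewrite mulSn => ? def_v; have := far i.+1 ltac:(lia) ltac:(lia); lia.
Qed.

(** * One-element exchanges and common neighbourhoods *)

Lemma diff1_sym A B : A \in stab -> B \in stab -> #|A :\: B| = 1 ->
  #|B :\: A| = 1.
Proof.
move=> stA stB; have := cardsID B A; have := cardsID A B.
by rewrite setIC (stable_card stA) (stable_card stB); lia.
Qed.

(** Seen from [y], both [low] and [high] miss [A]. Let [z] and [x] be the points exchanged between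
    [A] and [B]. The other points of [A] lie in [B], hence at distance at least [s] from [x]. So if
    [x] comes before [z], all points of [A] before [x] are far from it and [low] misses [x]; if it
    comes after, [high] does. *)
Lemma stable_escape A B y : A \in stab -> B \in stab -> #|A :\: B| = 1 ->
    y \notin A -> y \notin B ->
  exists2 C, C \in stab & [/\ y \in C, [disjoint A & C] & [disjoint B & C]].
Proof.
move=> stA stB dAB; have /eqP/cards1P[x def_x] := diff1_sym stA stB dAB.
have /eqP/cards1P[z def_z] := dAB.
have [p sp def_A] := stable_spread y stA.
rewrite {1}def_A spread0 // -lt0n => p0 yB.
have : z \in A :\: B by rewrite def_z set11.
rewrite inE {1}def_A => /andP[zB /spread_set_elem[j lt_j def_zj]].
have [v lt_v def_xv] := shift_surj y x.
have : x \in B :\: A by rewrite def_x set11.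
rewrite inE => /andP[xA xB].
have v0 : 0 < v.
  by rewrite lt0n; apply: contraNneq yB => v0; rewrite -(shift0 y) -v0 -def_xv.
have pB i : i < k -> i != j -> shift y (p i) \in B.
  move=> lt_i neq_ij; apply: contraT => piB.
  have : shift y (p i) \in A :\: B by rewrite inE piB def_A mem_spread_set_idx.
  rewrite def_z inE def_zj => /eqP/shift_inj.
  move=> /(_ (spread_lt sp lt_i) (spread_lt sp lt_j))/spread_inj eq_ij.
  by rewrite eq_ij ?eqxx in neq_ij.
rewrite def_xv in xB.
have neq_v i : i < k -> p i <> v.
  by move=> lt_i eq_v; case/negP: xA; rewrite def_xv -eq_v def_A mem_spread_set_idx.
suff [q [sq q0 neq_pq neq_vq]] : exists q, [/\ spread q, q 0 = 0,
    forall i j, i < k -> j < k -> q i <> p j & forall i, i < k -> q i <> v].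
  have dAC : [disjoint A & spread_set y q].
    by rewrite def_A; apply: spread_set_disjoint => // i l ? ? /esym; apply: neq_pq.
  exists (spread_set y q); first exact: spread_set_stable.
  rewrite spread0 // q0; split=> //.
  rewrite disjoint_subset; apply/subsetP=> w wB; apply/negP=> wC.
  have : w \in B :\: A by rewrite inE wB (disjointFl dAC wC).
  rewrite def_x def_xv inE => /eqP def_w.
  move: wC; rewrite def_w => /(mem_spread_set y sq lt_v)[i lt_i].
  exact: neq_vq.
case: (ltngtP v (p j)) => [lt_vj|gt_vj|/esym/(neq_v _ lt_j)] //.
  exists (low p); split=> // [|i l|i]; [exact: low_spread|exact: low_neq|].
  apply: low_avoid => // i' lt_i' lt_pv.
  have neq_i'j : i' != j by apply: contraTneq lt_pv => ->; lia.
  have := stable_far stB (spread_lt sp lt_i') lt_v lt_pv (pB _ lt_i' neq_i'j) xB.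
  lia.
exists (high p); split=> // [|i l|i]; [exact: high_spread|exact: high_neq|].
apply: high_avoid => // i' lt_i' lt_pv.
have neq_i'j : i' != j by apply: contraTneq lt_pv => ->; lia.
have := stable_far stB lt_v (spread_lt sp lt_i') lt_pv xB (pB _ lt_i' neq_i'j).
lia.
Qed.

(** Replacing [p j] by [q j] keeps a spread: the last two hypotheses give the gaps around [j], and
    for [j = k.-1] the closing gap is that of [q]. *)
Lemma spread_exchange a p q j : spread p -> spread q -> p 0 = 0 -> q 0 = 0 ->
    0 < j -> j < k -> q j <> p j -> p j.-1 + s <= q j ->
    (j.+1 < k -> q j + s <= p j.+1) ->
  exists2 D, D \in stab & D \subset spread_set a p :|: spread_set a q /\
    #|spread_set a p :\: D| = 1.
Proof.
move=> sp sq p0 q0 j0 lt_j neq_j lo hi; have [gp lp wp] := sp.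
pose r i := if i == j then q j else p i.
have sr : spread r.
  have [_ lq wq] := sq.
  split=> [i lt_i||]; rewrite /r.
  - case: (eqVneq i j) => [def_i|_].
      by rewrite def_i in lt_i *; case: eqP => [|_]; [lia | exact: hi].
    case: (eqVneq i.+1 j) => [def_j|_]; last exact: gp.
    by rewrite -def_j in lo *.
  - by case: eqP => [<-|_]; lia.
  - have /negPf-> : 0 != j by lia.
    by case: eqP => [<-|_]; lia.
have r_idx i : i < k -> i != j -> shift a (p i) \in spread_set a r.
  move=> lt_i neq_i; have <- : r i = p i by rewrite /r ifN.
  exact: mem_spread_set_idx.
exists (spread_set a r); first exact: spread_set_stable.
split.
  apply/subsetP=> x /spread_set_elem[i lt_i ->]; rewrite inE /r.
  by case: eqP => [_|_]; rewrite mem_spread_set_idx ?orbT.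
apply/eqP/cards1P; exists (shift a (p j)); apply/setP=> x; rewrite !inE.
apply/andP/eqP => [[xr /spread_set_elem[i lt_i def_x]]|->].
  by case: (eqVneq i j) => [<-//|neq_i]; case/negP: xr; rewrite def_x r_idx.
split; last exact: mem_spread_set_idx.
apply/negP=> /(mem_spread_set a sr (spread_lt sp lt_j))[i lt_i].
by rewrite /r; case: eqP => [_ /neq_j|neq_i /(spread_inj sp lt_i lt_j)].
Qed.

(** With a common point as base, take the least [j] with [q j < p j]: then [p j.-1 <= q j.-1], so
    [p j] can move down to [q j]. If there is none, take the greatest [j] with [p j < q j] and move
    [p j] up. *)
Lemma stable_exchange A B a : A \in stab -> B \in stab -> A != B ->
    a \in A -> a \in B ->
  exists2 D, D \in stab & D \subset A :|: B /\ #|A :\: D| = 1.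
Proof.
move=> stA stB neqAB.
have [p sp def_A] := stable_spread a stA; have [q sq def_B] := stable_spread a stB.
rewrite {1}def_A {1}def_B !spread0 // => /eqP p0 /eqP q0.
rewrite def_A def_B; have [[gp _ _] [gq _ _]] := (sp, sq).
have [/existsP|noless] := boolP [exists j : 'I_k, q j < p j].
  move=> [j0 lt_j0]; have exj : exists j, (j < k) && (q j < p j).
    by exists j0; rewrite ltn_ord.
  case: (ex_minnP exj) => j /andP[lt_j lt_qp] minj.
  have j0' : 0 < j by case: (j) lt_qp => //; lia.
  apply: (@spread_exchange a p q j) => //; first lia.
    have := gq j.-1; rewrite prednK // => /(_ lt_j).
    have [lt_qp'|] := ltnP (q j.-1) (p j.-1); last by lia.
    by have := minj j.-1 ltac:(lia); lia.
  by move=> lt_j1; have := gp j lt_j1; lia.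
have [/existsP|nomore] := boolP [exists j : 'I_k, p j < q j]; last first.
  case/eqP: neqAB; rewrite def_A def_B; apply: eq_spread_set => i lt_i.
  rewrite negb_exists in noless; rewrite negb_exists in nomore.
  have /forallP/(_ (Ordinal lt_i)) /= := noless.
  by have /forallP/(_ (Ordinal lt_i)) /= := nomore; lia.
move=> [j0 lt_j0]; have exj : exists j, (j < k) && (p j < q j).
  by exists j0; rewrite ltn_ord.
have ub j : (j < k) && (p j < q j) -> j <= k by lia.
case: (ex_maxnP exj ub) => j /andP[lt_j lt_pq] maxj.
have j0' : 0 < j by case: (j) lt_pq => //; lia.
apply: (@spread_exchange a p q j) => //; first lia.
  by have := gp j.-1; rewrite prednK // => /(_ lt_j); lia.
move=> lt_j1; have := gq j lt_j1.
have [lt_pq'|] := ltnP (p j.+1) (q j.+1); last by lia.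
by have := maxj j.+1 ltac:(lia); lia.
Qed.

(* The pairs with [|A \ B| = 1] are those for which the common neighbourhood of
   [A] and [B] is inclusion-maximal among the vertices not adjacent to [A]. *)
Lemma stable_diff1P A B : A \in stab -> B \in stab ->
  #|A :\: B| = 1 <->
  [/\ A != B, ~~ [disjoint A & B] &
    forall D, D \in stab -> D != A -> ~~ [disjoint A & D] ->
      (forall C, C \in stab -> [disjoint A & C] -> [disjoint B & C] ->
        [disjoint D & C]) ->
      forall C, C \in stab -> [disjoint A & C] -> [disjoint D & C] ->
        [disjoint B & C]].
Proof.
move=> stA stB; split=> [dAB|[neqAB ndAB maxB]].
  split.
  - by apply: contra_eqN dAB => /eqP->; rewrite setDv cards0.
  - apply: contraTN k_ge2; rewrite -setI_eq0 => /eqP dis.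
    by have := cardsID B A; rewrite dis cards0 dAB (stable_card stA); lia.
  (* A point of [D] outside [A :|: B] would lie on a stable set missing [A] and [B], which must miss
     [D]. Then [D] contains the only point of [B :\: A], for otherwise [D] would be [A]. *)
  move=> D stD neqDA _ subD.
  have sDU : D \subset A :|: B.
    apply/subsetP=> y yD; rewrite inE; apply: contraT; rewrite negb_or => /andP[yA yB].
    have [C stC [yC dAC dBC]] := stable_escape stA stB dAB yA yB.
    by have := subD C stC dAC dBC; move/disjointFr/(_ yD); rewrite yC.
  have sBU : B \subset A :|: D.
    have [x def_x] := cards1P (introT eqP (diff1_sym stA stB dAB)).
    have xD : x \in D.
      apply: contraR neqDA => xD; rewrite eqEcard (stable_card stD) (stable_card stA) leqnn andbT.
      apply/subsetP=> y yD; have := subsetP sDU y yD; rewrite inE => /orP[//|yB].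
      apply: contraT => yA; have : y \in B :\: A by rewrite inE yA.
      by rewrite def_x inE => /eqP eq_yx; rewrite -eq_yx yD in xD.
    apply/subsetP=> y yB; rewrite inE; case: (boolP (y \in A)) => //= yA.
    have : y \in B :\: A by rewrite inE yA.
    by rewrite def_x inE => /eqP->.
  move=> C stC dAC dDC; apply: disjointWl sBU _; rewrite -setI_eq0 setIUl setU_eq0.
  by rewrite !setI_eq0 dAC.
(* The common neighbours of [A] and [B] are also neighbours of the exchanged set [D]. Maximality
   gives the converse, which forces [B] into [A :|: D], so [B :\: A] has at most one point. *)
have [a aA aB] := disjointPn ndAB.
have [D stD [sDU dAD]] := stable_exchange stA stB neqAB aA aB.
have neqDA : D != A by apply: contra_eqN dAD => /eqP->; rewrite setDv cards0.
have ndAD : ~~ [disjoint A & D].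
  apply: contraTN k_ge2; rewrite -setI_eq0 => /eqP dis.
  by have := cardsID D A; rewrite dis cards0 dAD (stable_card stA); lia.
have {}maxB := maxB D stD neqDA ndAD.
have sBU : B \subset A :|: D.
  apply/subsetP=> y yB; rewrite inE; apply: contraT; rewrite negb_or => /andP[yA yD].
  have [C stC [yC dAC dDC]] := stable_escape stA stD dAD yA yD.
  suff /disjointFr/(_ yB) : [disjoint B & C] by rewrite yC.
  apply: maxB => // E stE dAE dBE; apply: disjointWl sDU _.
  by rewrite -setI_eq0 setIUl setU_eq0 !setI_eq0 dAE.
have : #|B :\: A| <= #|D :\: A|.
  by apply/subset_leq_card/subsetP=> y; rewrite !inE => /andP[yA /(subsetP sBU)]; rewrite inE (negPf yA).
rewrite (diff1_sym stA stD dAD) => leB.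
have : #|B :\: A| != 0.
  rewrite cards_eq0 setD_eq0; apply: contraNN neqAB => sBA.
  by rewrite eq_sym eqEcard sBA (stable_card stA) (stable_card stB) /=.
by move=> ?; apply: diff1_sym => //; lia.
Qed.

(** * Arcs that move the base point by one step *)

(* [up p] and [down p] replace the base point (offset 0) by its successor
   (offset 1) and its predecessor (offset [n.-1], now in last position). *)
Definition up p i := if i is 0 then 1 else p i.

Definition down p i := if i == k.-1 then n.-1 else p i.+1.

Lemma up_spread p : spread p -> p 0 = 0 -> s < p 1 -> spread (up p).
Proof.
move=> [gap last wrap] p0 p1; split=> [[|i] lt_i||] /=.
- by lia.
- exact: gap.
- by case: (k.-1) last => //=; lia.
- by case: (k.-1) wrap => //=; lia.
Qed.

Lemma down_spread p : spread p -> p 0 = 0 -> p k.-1 + s < n -> spread (down p).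
Proof.
move=> sp p0 pk; have [gap last wrap] := sp; split=> [i lt_i||]; rewrite /down.
- have /negPf-> : i != k.-1 by lia.
  case: eqP => [->|neq_i]; first by lia.
  by apply: gap; lia.
- by rewrite eqxx; lia.
- rewrite eqxx; have /negPf-> : 0 != k.-1 by lia.
  by have := gap 0 ltac:(lia); lia.
Qed.

Lemma up_arc a p : spread p -> p 0 = 0 -> s < p 1 ->
  spread_set a p :\: spread_set a (up p) = [set a].
Proof.
move=> sp p0 p1; apply: spread_set_diff => //; first exact: up_spread.
by move=> [|i] // _ lt_i; exists i.+1.
Qed.

Lemma down_arc a p : spread p -> p 0 = 0 -> p k.-1 + s < n ->
  spread_set a p :\: spread_set a (down p) = [set a].
Proof.
move=> sp p0 pk; apply: spread_set_diff => //; first exact: down_spread.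
  by rewrite /down; have := @spread_mono p 0 1 sp; case: eqP; lia.
move=> [|i] // _ lt_i; exists i; first by lia.
by rewrite /down; case: eqP => //; lia.
Qed.

(** If [D] misses the predecessor of [a], then [low] leaves room behind [a] for [down]. Otherwise
    [p k.-1 = n.-1], so [p 0 >= s - 1 >= 2], and [high] leaves room after [a] for [up]. *)
Lemma stable_arc_avoid D a : D \in stab -> a \notin D ->
  exists C E, [/\ C \in stab, E \in stab, C :\: E = [set a] & [disjoint C & D]].
Proof.
move=> stD; have [p sp ->] := stable_spread a stD; rewrite spread0 // -lt0n => p0.
have [gap last wrap] := sp.
have [lt_last|ge_last] := ltnP (p k.-1) n.-1.
  have sq := low_spread sp p0.
  have qk : low p k.-1 + s < n.
    case def_k: k.-1 => [|j] /=; first lia.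
    have := gap j ltac:(lia); have def_k' : k = j.+2 by lia.
    by move: lt_last n_gt; rewrite def_k' /= mulnC !mulSn; lia.
  exists (spread_set a (low p)), (spread_set a (down (low p))).
  split; [exact: spread_set_stable | | exact: down_arc | ].
    by apply: spread_set_stable; apply: down_spread.
  by apply: spread_set_disjoint => // i j; apply: low_neq.
have sq := high_spread sp p0.
have q1 : s < high p 1.
  have := gap 0 ltac:(lia); have := n_gt; rewrite /=.
  have -> : k = (k - 1).+1 by lia.
  by rewrite mulnS subSS subn0 mulnC; lia.
exists (spread_set a (high p)), (spread_set a (up (high p))).
split; [exact: spread_set_stable | | exact: up_arc | ].
  by apply: spread_set_stable; apply: up_spread.
by apply: spread_set_disjoint => // i j; apply: high_neq.
Qed.

(** * Connectedness of the arcs at one point *)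

Section Link.

(** No chain of links is built as an object: connectedness is expressed by showing that any function
    constant along links is constant on the arcs at [a]. *)
Variables (T : Type) (f : {set 'I_n} -> {set 'I_n} -> T).

(* The hypotheses force [A :&: C = [set a]] and [A :\: B = C :\: E = [set a]]. *)
Hypothesis f_link : forall A B C E,
  A \in stab -> B \in stab -> C \in stab -> E \in stab ->
  #|A :\: B| = 1 -> #|C :\: E| = 1 ->
  [disjoint B & C] -> [disjoint A & E] -> ~~ [disjoint A & C] ->
  f A B = f C E.

Variable a : 'I_n.

Lemma spread_link p p' q q' :
    spread p -> spread p' -> spread q -> spread q' -> p 0 = 0 -> q 0 = 0 ->
    spread_set a p :\: spread_set a p' = [set a] ->
    spread_set a q :\: spread_set a q' = [set a] ->
    (forall i j, i < k -> j < k -> p' i <> q j) ->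
    (forall i j, i < k -> j < k -> p i <> q' j) ->
  f (spread_set a p) (spread_set a p') = f (spread_set a q) (spread_set a q').
Proof.
move=> sp sp' sq sq' p0 q0 dp dq dis dis'.
apply: f_link; rewrite ?dp ?dq ?cards1 //; try exact: spread_set_stable.
- exact: spread_set_disjoint.
- exact: spread_set_disjoint.
- apply/negP=> /disjointFr/(_ (_ : a \in _)).
  by rewrite !spread0 // p0 q0 => /(_ isT).
Qed.

Let fup p := f (spread_set a p) (spread_set a (up p)).
Let fdown p := f (spread_set a p) (spread_set a (down p)).

Let raise p i := if i is 0 then 0 else (p i).+1.
Let lower p i := maxn (i * s) (p i).-1.

Lemma raise_spread p : spread p -> p 0 = 0 -> p k.-1 + s < n -> spread (raise p).
Proof.
move=> [gap last wrap] p0 pk; split=> [[|i] lt_i||] /=.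
- by have := gap 0 lt_i; lia.
- by have := gap i.+1 lt_i; lia.
- by case: (k.-1) pk => //=; lia.
- by case: (k.-1) pk => //=; lia.
Qed.

Lemma lower_spread p : spread p -> p 0 = 0 -> spread (lower p).
Proof.
move=> sp p0; have [gap last wrap] := sp; rewrite /lower; split=> [i lt_i||].
- by have := gap i lt_i; rewrite mulSn; lia.
- by have := @spread_gap p 0 k.-1 sp ltac:(lia); rewrite add0n; lia.
- by have := @spread_gap p 0 k.-1 sp ltac:(lia); rewrite add0n; lia.
Qed.

(* The elements of [raise p] lie 1 or 2 above those of [r]; since [s >= 3] they
   cannot meet [r]. *)
Lemma fdown_raise p r : spread p -> p 0 = 0 -> p k.-1 + s < n ->
    spread r -> r 0 = 0 -> (forall i, i < k -> (p i).-1 <= r i <= p i) ->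
  fdown r = fup (raise p).
Proof.
move=> sp p0 pk sr r0 close; rewrite /fdown /fup.
have rk : r k.-1 + s < n by have := close k.-1 ltac:(lia); lia.
have sq := raise_spread sp p0 pk.
have q1 : s < raise p 1 by have := @spread_mono p 0 1 sp; rewrite /=; lia.
have neq i j : 0 < i -> i < k -> j < k -> r i <> raise p j.
  move=> i0 lt_i lt_j; case: j lt_j => [|j] lt_j /=.
    by have := @spread_mono r 0 i sr; lia.
  case: (ltngtP i j.+1) => [lt_ij|lt_ji|->].
  - have := spread_mono sp lt_ij lt_j; have := close i lt_i; lia.
  - have := spread_mono sp lt_ji lt_i; have := close i lt_i; lia.
  - have := close j.+1 lt_j; lia.
apply: spread_link; rewrite ?r0 //.
- exact: down_spread.
- exact: up_spread.
- exact: down_arc.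
- exact: up_arc.
(* The new last offset [n.-1] is out of reach: the offsets of [raise p] are at most
   [p k.-1 + 1 <= n - s]. *)
- move=> i j lt_i lt_j; rewrite /down; case: eqP => [_|neq_i]; last first.
    by apply: neq => //; lia.
  case: j lt_j => [|j] lt_j /=; first lia.
  by have := spread_le sp (_ : j.+1 <= k.-1); lia.
- move=> [|i] [|j] lt_i lt_j /=; rewrite ?r0 //.
    by have := @spread_mono r 0 i.+1 sr; lia.
  exact: neq i.+1 j.+1 isT lt_i lt_j.
Qed.

(** Both [p] and [lower p] are close enough to [p] to be linked with the same arc, the [up] arc of
    [raise p]. *)
Lemma fdown_lower p : spread p -> p 0 = 0 -> p k.-1 + s < n ->
  fdown p = fdown (lower p).
Proof.
move=> sp p0 pk; rewrite (@fdown_raise p p) // => [|i lt_i]; last lia.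
rewrite (@fdown_raise p (lower p)) //; first exact: lower_spread.
  by rewrite /lower p0; lia.
move=> i lt_i; rewrite /lower.
by have := @spread_gap p 0 i sp ltac:(lia); rewrite add0n; lia.
Qed.

Let packed i := i * s.

Lemma eq_fdown p q : (forall i, i < k -> p i = q i) -> fdown p = fdown q.
Proof.
move=> eq_pq; rewrite /fdown (eq_spread_set a eq_pq); congr (f _ _).
apply: eq_spread_set => i lt_i; rewrite /down; case: eqP => // neq_i.
by apply: eq_pq; lia.
Qed.

(** Iterating [lower] decreases the last offset until it reaches [k.-1 * s]; every gap is then
    exactly [s]. *)
Lemma fdown_packed p : spread p -> p 0 = 0 -> p k.-1 + s < n ->
  fdown p = fdown packed.
Proof.
move: {2}(p k.-1) (leqnn (p k.-1)) => m.
elim: m p => [|m IHm] p le_m sp p0 pk.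
  by have := @spread_mono p 0 k.-1 sp; lia.
have [lt_k|le_k] := ltnP (k.-1 * s) (p k.-1).
  rewrite fdown_lower // IHm //; rewrite /lower.
  - by rewrite geq_max; lia.
  - exact: lower_spread.
  - by rewrite p0; lia.
  - by lia.
apply: eq_fdown => i lt_i; rewrite /packed; apply/eqP; rewrite eqn_leq.
have := @spread_gap p 0 i sp lt_i; rewrite add0n p0 => ->; rewrite andbT.
have := @spread_gap p i (k.-1 - i) sp ltac:(lia).
rewrite subnKC; last by lia.
have : k.-1 * s = i * s + (k.-1 - i) * s by rewrite -mulnDl subnKC //; lia.
by lia.
Qed.

Lemma fup_packed q : spread q -> q 0 = 0 -> s < q 1 -> fup q = fdown packed.
Proof.
move=> sq q0 q1; have [gap last wrap] := sq.
(* This inverts [raise]: truncation keeps the offset 0 in place, and [s < q 1] keeps the first gap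
   large enough. *)
pose p i := (q i).-1.
have qpos i : 0 < i -> i < k -> s < q i.
  move=> i0 lt_i; have := @spread_le q 1 i sq i0 lt_i; lia.
have sp : spread p.
  split=> [[|i] lt_i||]; rewrite /p.
  - by lia.
  - by have := gap i.+1 lt_i; have := qpos i.+1 isT ltac:(lia); lia.
  - by lia.
  - by have := qpos k.-1 ltac:(lia) ltac:(lia); lia.
have pk : p k.-1 + s < n by have := qpos k.-1 ltac:(lia) ltac:(lia); rewrite /p; lia.
have p0 : p 0 = 0 by rewrite /p q0.
rewrite -(@fdown_packed p) // (@fdown_raise p p) //; last by move=> i _; lia.
rewrite /fup; congr (f _ _); apply: eq_spread_set => [[|i]] lt_i //=.
  by have := qpos i.+1 isT lt_i; rewrite /p; lia.
by have := qpos i.+1 isT lt_i; rewrite /p; lia.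
Qed.

(** A general arc exchanges [a] for a point [x] at any offset [v]. One link takes it to an [up] or
    [down] arc of a set [q] through [a], and those are already settled. *)
Lemma f_arc A B : A \in stab -> B \in stab -> A :\: B = [set a] ->
  f A B = fdown packed.
Proof.
move=> stA stB dAB.
have [p sp def_A] := stable_spread a stA; have [p' sp' def_B] := stable_spread a stB.
have /setP/(_ a) := dAB; rewrite !inE eqxx => /andP[].
rewrite {1}def_A {1}def_B !spread0 // => p'0 /eqP p0.
have dAB1 : #|A :\: B| = 1 by rewrite dAB cards1.
have /eqP/cards1P[x def_x] := diff1_sym stA stB dAB1.
have [v lt_v def_v] := shift_surj a x.
have : x \in B :\: A by rewrite def_x set11.
rewrite inE def_v => /andP[xA xB].
have v0 : 0 < v.
  rewrite lt0n; apply: contraNneq p'0 => v0.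
  by rewrite -(spread0 a sp') -def_B -(shift0 a) -v0.
have pB i : 0 < i -> i < k -> shift a (p i) \in B.
  move=> i0 lt_i; apply: contraT => piB.
  have : shift a (p i) \in A :\: B by rewrite inE piB def_A mem_spread_set_idx.
  rewrite dAB inE -{2}(shift0 a) => /eqP/shift_inj.
  move=> /(_ (spread_lt sp lt_i) ltac:(lia)).
  by have := spread_mono sp i0 lt_i; lia.
have neq_v i : i < k -> p i <> v.
  by move=> lt_i eq_v; case/negP: xA; rewrite -eq_v def_A mem_spread_set_idx.
have farl i : 0 < i -> i < k -> p i < v -> p i + s <= v.
  move=> i0 lt_i lt_pv.
  by have := stable_far stB (spread_lt sp lt_i) lt_v lt_pv (pB _ i0 lt_i) xB; lia.
have farr i : 0 < i -> i < k -> v < p i -> v + s <= p i.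
  move=> i0 lt_i lt_pv.
  by have := stable_far stB lt_v (spread_lt sp lt_i) lt_pv xB (pB _ i0 lt_i); lia.
have p'E j : j < k -> p' j = v \/ exists2 i, 0 < i < k & p' j = p i.
  move=> lt_j; have [p'A|p'A] := boolP (shift a (p' j) \in A); last first.
    left; have : shift a (p' j) \in B :\: A by rewrite inE p'A def_B mem_spread_set_idx.
    by rewrite def_x def_v inE => /eqP/shift_inj-> //; apply: spread_lt.
  right; move: p'A; rewrite def_A => /(mem_spread_set a sp (spread_lt sp' lt_j))[i lt_i pi].
  exists i; rewrite // lt_i andbT lt0n; apply: contra_neq p'0 => i0.
  by have := spread_le sp' (leq0n j) lt_j; rewrite -pi i0 p0; lia.
have [gap last wrap] := sp.
(* Every point of [A] but [a] moves one step towards [v]. There is room since these points are at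
   distance at least [s] from [v]; the new ones avoid [v] and, as [s >= 3], the old ones. *)
pose q i := if i is 0 then 0 else if p i < v then (p i).+1 else (p i).-1.
have sq : spread q.
  split=> [[|i] lt_i||] /=.
  - have := gap 0 lt_i; have := farr 1 isT lt_i; have := neq_v 1 lt_i.
    by case: (ltnP (p 1) v); lia.
  - have := gap i.+1 lt_i; have := neq_v i.+1; have := neq_v i.+2 lt_i.
    have := farr i.+2 isT lt_i; have := farl i.+1 isT.
    by case: (ltnP (p i.+1) v); case: (ltnP (p i.+2) v); lia.
  - by have := farl k.-1; case: (k.-1) last => /= [|j]; [lia|case: (ltnP (p j.+1) v); lia].
  - have := farl k.-1 ltac:(lia) ltac:(lia).
    by case: (k.-1) wrap => /= [|j]; [lia|case: (ltnP (p j.+1) v); lia].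
have dpq i j : 0 < i -> i < k -> j < k -> p i <> q j.
  case: j => [|j] i0 lt_i lt_j; first by have := spread_mono sp i0 lt_i; rewrite /=; lia.
  have := spread_mono sp (ltn0Sn j) lt_j.
  case: (ltngtP i j.+1) => [lt_ij|lt_ji|->] /=.
  - by have := spread_mono sp lt_ij lt_j; case: (ltnP (p j.+1) v); lia.
  - by have := spread_mono sp lt_ji lt_i; case: (ltnP (p j.+1) v); lia.
  - by case: (ltnP (p j.+1) v); lia.
have dp'q i j : i < k -> j < k -> p' i <> q j.
  move=> lt_i lt_j; case: (p'E i lt_i) => [->|[l /andP[l0 lt_l] ->]]; last exact: dpq.
  case: j lt_j => [|j] lt_j /=; first by lia.
  by have := farl j.+1 isT lt_j; have := farr j.+1 isT lt_j; have := neq_v j.+1 lt_j; case: (ltnP (p j.+1) v); lia.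
rewrite def_A def_B in dAB *.
(* If a point precedes [v], the first one moved away from [a] and [up] applies. Otherwise all moved
   back, which frees the last gap for [down]. *)
have [lt_p1v|le_vp1] := ltnP (p 1) v.
  have q1 : s < q 1 by rewrite /= lt_p1v; have := gap 0 ltac:(lia); lia.
  rewrite -(@fup_packed q) // /fup.
  apply: spread_link => //; [exact: up_spread | exact: up_arc |].
  move=> [|i] [|j] lt_i lt_j.
  - by rewrite p0.
  - by rewrite p0 -[up q j.+1]/(q j.+1); have := @spread_mono q 0 j.+1 sq; lia.
  - by rewrite /=; have := @spread_mono p 0 i.+1 sp; lia.
  - exact: dpq.
have qk : q k.-1 + s < n.
  have := @spread_le p 1 k.-1 sp ltac:(lia) ltac:(lia).
  have := neq_v k.-1 ltac:(lia).
  by case def_k: k.-1 => [|j] //=; [lia|rewrite -def_k; case: (ltnP (p k.-1) v); lia].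
rewrite -(@fdown_packed q) // /fdown.
apply: spread_link => //; [exact: down_spread | exact: down_arc |].
move=> i j lt_i lt_j; rewrite /down; case: eqP => [_|neq_j].
  have := @spread_le p i k.-1 sp ltac:(lia) ltac:(lia).
  by have := farr k.-1; have := @spread_le p 1 k.-1 sp ltac:(lia) ltac:(lia); have := neq_v k.-1; lia.
case: i lt_i => [|i] lt_i; last by apply: dpq => //; lia.
by rewrite p0; have := @spread_mono q 0 j.+1 sq; lia.
Qed.

End Link.

(** * Disjointness-preserving bijections come from permutations of the points *)

(** As [s * k < n], gaps of exactly [s] from [a] on leave a larger last gap, so [a] can step
    back. *)
Lemma arc_exists a : exists A B, [/\ A \in stab, B \in stab & A :\: B = [set a]].
Proof.
pose p i := i * s.
have sp : spread p.
  by split=> [i lt_i||]; rewrite /p; have := n_gt; rewrite mulnC -(ltn_predK k_ge2) /= mulSn; lia.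
have pk : p k.-1 + s < n.
  by rewrite /p; have := n_gt; rewrite mulnC -{1}(ltn_predK k_ge2) mulSn; lia.
exists (spread_set a p), (spread_set a (down p)); split.
- exact: spread_set_stable.
- by apply: spread_set_stable; apply: down_spread.
- exact: down_arc.
Qed.

(** A common point of [A] and [C] lies in neither [B] nor [E], so it is the only element of both
    differences. *)
Lemma link_diff A B C E : #|A :\: B| = 1 -> #|C :\: E| = 1 ->
    [disjoint B & C] -> [disjoint A & E] -> ~~ [disjoint A & C] ->
  A :\: B = C :\: E.
Proof.
move=> /eqP/cards1P[x dAB] /eqP/cards1P[y dCE] dBC dAE /disjointPn[z zA zC].
have : z \in A :\: B by rewrite inE zA (disjointFl dBC zC).
have : z \in C :\: E by rewrite inE zC (disjointFr dAE zA).
by rewrite dAB dCE !inE => /eqP<- /eqP<-.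
Qed.

(** An automorphism and its inverse, as functions on all sets constrained only on the stable ones;
    this avoids working in the vertex subtype. *)
Definition stable_iso (F G : {set 'I_n} -> {set 'I_n}) :=
  [/\ {in stab, forall A, F A \in stab}, {in stab, forall A, G A \in stab},
      {in stab, cancel F G}, {in stab, cancel G F}
    & {in stab &, forall A B, [disjoint F A & F B] = [disjoint A & B]}].

Lemma stable_iso_sym F G : stable_iso F G -> stable_iso G F.
Proof.
case=> FS GS FK GK dF; split=> // A B stA stB.
by rewrite -dF ?GS // !GK.
Qed.

(** The characterisation [stable_diff1P] mentions only equality and disjointness of stable sets, so
    it can be pulled back along [G]. *)
Lemma stable_iso_diff1 F G A B : stable_iso F G -> A \in stab -> B \in stab ->
  #|A :\: B| = 1 -> #|F A :\: F B| = 1.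
Proof.
case=> FS GS FK GK dF stA stB /(stable_diff1P stA stB)[neqAB ndAB maxB].
apply/(stable_diff1P (FS A stA) (FS B stB)); split; rewrite ?dF //.
  by apply: contra_neq neqAB => eqF; rewrite -(FK A) // eqF FK.
move=> D stD neqDA ndAD subD C stC dAC dDC.
rewrite -(GK C) // dF ?GS //; apply: (maxB (G D)); rewrite ?GS //.
- by apply: contra_neq neqDA => <-; rewrite GK.
- by rewrite -dF ?GS // GK.
- move=> C' stC' dAC' dBC'; rewrite -dF ?GS // GK //.
  by apply: subD; rewrite ?FS ?dF.
- by rewrite -dF ?GS // GK.
- by rewrite -dF ?GS // !GK.
Qed.

Lemma stable_iso_arc F G : stable_iso F G ->
  exists h : 'I_n -> 'I_n, forall a A B, A \in stab -> B \in stab ->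
    A :\: B = [set a] -> F A :\: F B = [set h a].
Proof.
move=> isoF; have [FS GS FK GK dF] := isoF.
suff /fin_all_exists[h hP] : forall a, exists b, forall A B, A \in stab ->
    B \in stab -> A :\: B = [set a] -> F A :\: F B = [set b] by exists h.
move=> a; have [A [B [stA stB dAB]]] := arc_exists a.
have dAB1 : #|A :\: B| = 1 by rewrite dAB cards1.
have /eqP/cards1P[b def_b] := stable_iso_diff1 isoF stA stB dAB1.
exists b => A' B' stA' stB' dAB'; rewrite -def_b.
pose f A B := F A :\: F B; rewrite -![F _ :\: F _]/(f _ _).
have f_link C D C' D' : C \in stab -> D \in stab -> C' \in stab -> D' \in stab ->
    #|C :\: D| = 1 -> #|C' :\: D'| = 1 ->
    [disjoint D & C'] -> [disjoint C & D'] -> ~~ [disjoint C & C'] ->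
    f C D = f C' D'.
  move=> stC stD stC' stD' d1 d2 *; apply: link_diff; rewrite ?dF //.
    exact: stable_iso_diff1 isoF stC stD d1.
  exact: stable_iso_diff1 isoF stC' stD' d2.
by rewrite (f_arc f_link stA stB dAB) (f_arc f_link stA' stB' dAB').
Qed.

Lemma stable_iso_perm F G : stable_iso F G ->
  exists g : {perm 'I_n}, {in stab, forall A, F A = g @: A}.
Proof.
move=> isoF; have [FS GS FK GK dF] := isoF.
have [h hP] := stable_iso_arc isoF.
have [h' h'P] := stable_iso_arc (stable_iso_sym isoF).
(* [F] sends an arc at [a] to one at [h a], and [G] sends that one back to the original. *)
have hK : cancel h h'.
  move=> a; have [A [B [stA stB dAB]]] := arc_exists a; apply: set1_inj.
  by rewrite -dAB -(h'P _ _ _ (FS _ stA) (FS _ stB) (hP _ _ _ stA stB dAB)) !FK.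
exists (perm (can_inj hK)) => D stD; apply/eqP.
rewrite eqEcard card_imset ?(stable_card stD) ?(stable_card (FS D stD)) //; last exact: perm_inj.
rewrite leqnn andbT; apply/subsetP=> y; have [a <-] : exists a, perm (can_inj hK) a = y.
  by exists ((perm (can_inj hK))^-1 y)%g; rewrite permKV.
move=> yF; apply: imset_f; apply: contraLR yF => aD.
have [C [E [stC stE dCE dCD]]] := stable_arc_avoid stD aD.
have /setP/(_ (h a)) := hP _ _ _ stC stE dCE.
rewrite !inE eqxx permE => /andP[_ haC].
by rewrite (disjointFr _ haC) // dF.
Qed.

(** Every singleton is a difference of two stable sets. *)
Lemma stable_perm_inj (g h : {perm 'I_n}) :
  {in stab, forall A, g @: A = h @: A} -> g = h.
Proof.
move=> eq_gh; apply/permP=> a; have [A [B [stA stB dAB]]] := arc_exists a.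
by apply: set1_inj; rewrite -!imset_set1 -dAB !perm_imsetD !eq_gh.
Qed.

(** * The isomorphism between the automorphism groups *)

Local Notation vertex := (stable_kneser_vertex n k s).
Local Notation KG := (@stable_kneser n k s).
Local Notation SG := (@stable_graph n k s).
Implicit Types (f : {perm vertex}) (g h : {perm 'I_n}).

Definition set_map f A := if insub A is Some v then val (f v) else A.

Lemma set_map_val f (v : vertex) : set_map f (val v) = val (f v).
Proof. by rewrite /set_map valK. Qed.

Lemma stabP A : A \in stab -> exists v : vertex, A = val v.
Proof. by move=> stA; exists (Sub A stA); rewrite SubK. Qed.

Lemma set_map_iso f : f \in graph_aut KG -> stable_iso (set_map f) (set_map f^-1).
Proof.
move=> /graph_autP autf; split=> [A|A|A|A|A B].
- by move=> /stabP[v ->]; rewrite set_map_val; apply: valP.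
- by move=> /stabP[v ->]; rewrite set_map_val; apply: valP.
- by move=> /stabP[v ->]; rewrite !set_map_val permK.
- by move=> /stabP[v ->]; rewrite !set_map_val permKV.
- by move=> /stabP[v ->] /stabP[w ->]; rewrite !set_map_val; apply: autf.
Qed.

Definition induces g f := [forall v, val (f v) == g @: val v].

Lemma inducesP g f : reflect (forall v, val (f v) = g @: val v) (induces g f).
Proof. by apply: (iffP forallP) => fg v; apply/eqP; rewrite fg. Qed.

(** The default 1 is taken only when no permutation induces [f]; an inducing one is unique by
    [induces_inj]. *)
Definition ground_perm f : {perm 'I_n} := odflt 1%g [pick g | induces g f].

Lemma ground_perm_induces f : f \in graph_aut KG -> induces (ground_perm f) f.
Proof.
move=> autf; rewrite /ground_perm; case: pickP => //= no_g.
have [g gP] := stable_iso_perm (set_map_iso autf).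
have /inducesP[] := no_g g => v.
by rewrite -set_map_val gP //; apply: valP.
Qed.

Lemma induces_inj g h f : induces g f -> induces h f -> g = h.
Proof.
move=> /inducesP gf /inducesP hf; apply: stable_perm_inj => A /stabP[v ->].
by rewrite -gf hf.
Qed.

Lemma inducesM g g' f f' : induces g f -> induces g' f' ->
  induces (g * g')%g (f * f')%g.
Proof.
move=> /inducesP gf /inducesP gf'; apply/inducesP=> v.
by rewrite permM gf' gf -imset_comp; apply: eq_imset => x; rewrite permM.
Qed.

(** Adjacency in [SG] depends only on the family of stable sets, which [g] permutes because [f] is a
    bijection on vertices. *)
Lemma induces_aut g f : induces g f -> g \in graph_aut SG.
Proof.
move=> /inducesP gf; apply/graph_autP=> i j.
rewrite /stable_graph (inj_eq perm_inj); congr (_ && ~~ _).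
apply/exists_inP/exists_inP=> [[S /stabP[v ->]]|[S /stabP[v ->]]] sijS.
  exists (val (f^-1 v)%g); first exact: valP.
  have /(f_equal val) : f (f^-1 v)%g = v by rewrite permKV.
  rewrite gf => def_v; move: sijS; rewrite -def_v !subUset !sub1set.
  by rewrite !mem_imset; try exact: perm_inj.
exists (val (f v)); first exact: valP.
rewrite gf; move: sijS; rewrite !subUset !sub1set.
by rewrite !mem_imset; try exact: perm_inj.
Qed.

(** Two points of [A] are not adjacent in [SG], so neither are their images. Distinct images thus
    lie in a common stable set, which bounds their distance. *)
Lemma stable_graph_aut_stab g A : g \in graph_aut SG -> A \in stab -> g @: A \in stab.
Proof.
move=> /graph_autP autg stA; rewrite inE card_imset ?(stable_card stA) ?eqxx /=; last exact: perm_inj.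
apply/forall_inP=> _ /imsetP[i iA ->]; apply/forall_inP=> _ /imsetP[j jA ->].
apply/implyP=> neq_ij; have : SG i j = false.
  apply/negP=> /andP[_ /exists_inP[]]; exists A => //.
  by rewrite subUset !sub1set iA.
rewrite -autg /stable_graph neq_ij /= => /negbFE/exists_inP[S].
rewrite inE => /andP[_ /forall_inP stS]; rewrite subUset !sub1set => /andP[iS jS].
by have /forall_inP/(_ _ jS) := stS _ iS; rewrite neq_ij.
Qed.

Lemma stable_graph_aut_induces g : g \in graph_aut SG ->
  exists2 f, f \in graph_aut KG & induces g f.
Proof.
move=> autg.
pose F (v : vertex) : vertex := Sub (g @: val v) (stable_graph_aut_stab autg (valP v)).
have F_inj : injective F.
  by move=> v w /(f_equal val) /= /(imset_inj perm_inj)/val_inj.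
exists (perm F_inj); last by apply/inducesP=> v; rewrite permE.
apply/graph_autP=> v w; rewrite /stable_kneser !permE /= -!setI_eq0.
by rewrite -imsetI ?imset_eq0 // => x y _ _; apply: perm_inj.
Qed.

Lemma ground_permM : {in graph_aut KG &, {morph ground_perm : f f' / (f * f')%g}}.
Proof.
move=> f f' autf autf'; apply: (@induces_inj _ _ (f * f')%g).
  by apply: ground_perm_induces; rewrite groupM.
by apply: inducesM; apply: ground_perm_induces.
Qed.

Lemma stable_kneser_aut_isog : graph_aut KG \isog graph_aut SG.
Proof.
apply: (isom_isog (Morphism ground_permM)); first by [].
apply/isomP; split.
  apply/injmP=> f f' autf autf' /= eq_g; apply/permP=> v; apply: val_inj.
  have /inducesP-> := ground_perm_induces autf.
  by have /inducesP-> := ground_perm_induces autf'; rewrite eq_g.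
apply/setP=> g; rewrite morphimEdom; apply/imsetP/idP => [[f autf ->]|autg].
  exact: induces_aut (ground_perm_induces autf).
have [f autf gf] := stable_graph_aut_induces autg; exists f => //.
exact: induces_inj gf (ground_perm_induces autf).
Qed.

End StableSets.

Theorem theorem2 (n s k : nat) (hk : (2 <= k)%N) (hs : (3 <= s)%N)
    (hn : (s * k + 1 <= n)%N) :
  graph_aut (@stable_kneser n k s) \isog graph_aut (@stable_graph n k s).
Proof. by rewrite addn1 in hn; apply: stable_kneser_aut_isog. Qed.
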